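(* Let $k$ be a positive integer. Then, as formal power series in $q$ (equivalently, for complex $|q|<1$), $$(-q;q)_\infty \sum_{n=0}^{2k-1} (-1)^{T_n} q^{2G_n} = \frac{(q^2;q^2)_\infty}{(q;q^2)_\infty}+(-1)^{k-1} \frac{(q^2;q^2)_\infty}{(q;q^2)_\infty} \sum_{n=1}^{\infty} \frac{q^{k(k-1)+2(k+1)n}}{(q^2;q^2)_n} \begin{bmatrix} n-1\\k-1 \end{bmatrix}_{q^2}.$$
   Context: For a nonnegative integer $n$, $T_n=n(n+1)/2$ is the $n$th triangular number and $G_n=T_n-T_{\lfloor n/2\rfloor}$ is the $n$th generalized pentagonal number. The $q$-Pochhammer symbol is $(a;q)_0=1$, $(a;q)_n=(1-a)(1-aq)\cdots(1-aq^{n-1})$ for $n>0$, and $(a;q)_\infty=\lim_{n\to\infty}(a;q)_n$. The Gaussian binomial coefficient $\begin{bmatrix} n\\k\end{bmatrix}_{q}$ equals $0$ if $k<0$ or $k>n$, and $\frac{(q;q)_n}{(q;q)_k(q;q)_{n-k}}$ otherwise; the subscript $q^2$ means $q$ is replaced by $q^2$. *)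

(* Defs.v *)
From HB Require Import structures.
From mathcomp Require Import all_boot all_order all_algebra.
From mathcomp Require Import boolp.

Set Implicit Arguments.
Unset Strict Implicit.
Unset Printing Implicit Defensive.

Import GRing.Theory.
Local Open Scope ring_scope.

Record fps (R : Type) := FPS { fps_coef : nat -> R }.

Notation "f ``_ n" := (fps_coef f n)
  (at level 3, n at level 2, left associativity, format "f ``_ n").

HB.instance Definition _ (R : Type) := gen_eqMixin (fps R).
HB.instance Definition _ (R : Type) := gen_choiceMixin (fps R).

Lemma fpsP (R : Type) (f g : fps R) : (forall n, f``_n = g``_n) <-> f = g.
Proof.
by case: f g => f [g]; split=> [fg|->//]; congr FPS; apply/funext.
Qed.

Section FpsRing.
Variable R : comNzRingType.
Implicit Types (f g h : fps R) (m n N : nat).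

Definition fps_zero : fps R := FPS (fun _ => 0).
Definition fps_one : fps R := FPS (fun n => (n == 0%N)%:R).
Definition fps_opp f : fps R := FPS (fun n => - f``_n).
Definition fps_add f g : fps R := FPS (fun n => f``_n + g``_n).
Definition fps_mul f g : fps R :=
  FPS (fun n => \sum_(i < n.+1) f``_i * g``_(n - i)).

Fact fps_addA : associative fps_add.
Proof. by move=> f g h; apply/fpsP => n /=; rewrite addrA. Qed.
Fact fps_addC : commutative fps_add.
Proof. by move=> f g; apply/fpsP => n /=; rewrite addrC. Qed.
Fact fps_add0 : left_id fps_zero fps_add.
Proof. by move=> f; apply/fpsP => n /=; rewrite add0r. Qed.
Fact fps_addN : left_inverse fps_zero fps_opp fps_add.
Proof. by move=> f; apply/fpsP => n /=; rewrite addNr. Qed.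

HB.instance Definition _ := GRing.isZmodule.Build (fps R)
  fps_addA fps_addC fps_add0 fps_addN.

Definition fps_trunc N f : {poly R} := \poly_(i < N) f``_i.

Lemma coef_fps_trunc N f n : (n < N)%N -> (fps_trunc N f)`_n = f``_n.
Proof. by move=> nN; rewrite coef_poly nN. Qed.

Fact fps_mul_polyE (p r : {poly R}) f g N n : (n < N)%N ->
    (forall i, (i < N)%N -> p`_i = f``_i) ->
    (forall i, (i < N)%N -> r`_i = g``_i) ->
  (fps_mul f g)``_n = (p * r)`_n.
Proof.
move=> nN pf rg; rewrite coefM /=; apply: eq_bigr => i _.
rewrite pf ?rg //; first exact: leq_ltn_trans (leq_subr _ _) nN.
by apply: leq_ltn_trans nN; rewrite -ltnS.
Qed.

Fact fps_mulC : commutative fps_mul.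
Proof.
move=> f g; apply/fpsP => n.
have tE := fun f => @coef_fps_trunc n.+1 f.
rewrite (fps_mul_polyE (ltnSn n) (tE f) (tE g)).
by rewrite (fps_mul_polyE (ltnSn n) (tE g) (tE f)) mulrC.
Qed.

Fact fps_mulA : associative fps_mul.
Proof.
move=> f g h; apply/fpsP => n.
have tE := fun f => @coef_fps_trunc n.+1 f.
have t2E f1 f2 i : (i < n.+1)%N ->
    (fps_trunc n.+1 f1 * fps_trunc n.+1 f2)`_i = (fps_mul f1 f2)``_i.
  by move=> ?; rewrite -(fps_mul_polyE (N := n.+1) _ (tE f1) (tE f2)).
rewrite (fps_mul_polyE (ltnSn n) (tE f) (t2E g h)).
by rewrite (fps_mul_polyE (ltnSn n) (t2E f g) (tE h)) mulrA.
Qed.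

Fact fps_mul1 : left_id fps_one fps_mul.
Proof.
move=> f; apply/fpsP => n /=; rewrite big_ord_recl /= mul1r subn0.
by rewrite big1 ?addr0 // => i _; rewrite mul0r.
Qed.

Fact fps_mulD : left_distributive fps_mul fps_add.
Proof.
move=> f g h; apply/fpsP => n /=; rewrite -big_split /=.
by apply: eq_bigr => i _; rewrite mulrDl.
Qed.

Fact fps_oner_neq0 : fps_one != fps_zero.
Proof. by apply/eqP => /fpsP /(_ 0%N) /eqP; rewrite /= oner_eq0. Qed.

HB.instance Definition _ := GRing.Zmodule_isComNzRing.Build (fps R)
  fps_mulA fps_mulC fps_mul1 fps_mulD fps_oner_neq0.

Definition fps_unit f : bool := `[< exists g, g * f = 1 >].
Definition fps_inv f : fps R :=
  if pselect (exists g, g * f = 1) is left fU then projT1 (cid fU) else f.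

Fact fps_mulV : {in fps_unit, left_inverse 1 fps_inv *%R}.
Proof.
move=> f /asboolP fU; rewrite /fps_inv.
by case: pselect => // fU'; case: cid.
Qed.
Fact fps_unitP f g : g * f = 1 -> fps_unit f.
Proof. by move=> gf; apply/asboolP; exists g. Qed.
Fact fps_inv_out : {in [predC fps_unit], fps_inv =1 id}.
Proof.
move=> f /negP fNU; rewrite /fps_inv; case: pselect => // fU.
by case: fNU; apply/asboolP.
Qed.

HB.instance Definition _ := GRing.ComNzRing_hasMulInverse.Build (fps R)
  fps_mulV fps_unitP fps_inv_out.

Definition fpsX : fps R := FPS (fun n => (n == 1%N)%:R).

Definition fps_cvg_to (u : nat -> fps R) (l : fps R) : Prop :=
  forall m, exists N, forall n, (N <= n)%N -> (u n)``_m = l``_m.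

(* Junk value 0 when u does not converge. *)
Definition fps_lim (u : nat -> fps R) : fps R :=
  if pselect (exists l, fps_cvg_to u l) is left ul then projT1 (cid ul) else 0.

Definition fps_series (m : nat) (u : nat -> fps R) : fps R :=
  fps_lim (fun N => \sum_(m <= n < N) u n).

Definition qpoch (a q : fps R) (n : nat) : fps R :=
  \prod_(i < n) (1 - a * q ^+ i).

Definition qpoch_inf (a q : fps R) : fps R := fps_lim (qpoch a q).

Definition qbinom (q : fps R) (n k : nat) : fps R :=
  if (k <= n)%N then qpoch q q n / (qpoch q q k * qpoch q q (n - k)) else 0.

End FpsRing.

Definition triangular (n : nat) : nat := (n * (n + 1)) %/ 2.

Definition gen_pentagonal (n : nat) : nat :=
  triangular n - triangular (n %/ 2).

(* The remaining lemmas show that the quotients, limits and infinite sums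
   formed from the above with series in q do not take junk values. *)
Section WellDefined.
Variable R : comNzRingType.
Implicit Types (f g l : fps R) (u : nat -> fps R) (m n N : nat).

Lemma fps_cvg_unique u l1 l2 : fps_cvg_to u l1 -> fps_cvg_to u l2 -> l1 = l2.
Proof.
move=> ul1 ul2; apply/fpsP => m.
have [N1 uN1] := ul1 m; have [N2 uN2] := ul2 m.
by rewrite -(uN1 (maxn N1 N2)) ?leq_maxl // uN2 // leq_maxr.
Qed.

Lemma fps_limE u l : fps_cvg_to u l -> fps_lim u = l.
Proof.
move=> ul; rewrite /fps_lim; case: pselect => [ul'|[]]; last by exists l.
by case: cid => l' /= /fps_cvg_unique; apply.
Qed.

Lemma fps_coefD f g n : (f + g)``_n = f``_n + g``_n. Proof. by []. Qed.

Lemma fps_coefN f n : (- f)``_n = - f``_n. Proof. by []. Qed.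

Lemma fps_coefM f g n : (f * g)``_n = \sum_(i < n.+1) f``_i * g``_(n - i).
Proof. by []. Qed.

Definition fps_ord_ge N f : Prop := forall m, (m < N)%N -> f``_m = 0.

Lemma fps_ord_geM N1 N2 f g :
  fps_ord_ge N1 f -> fps_ord_ge N2 g -> fps_ord_ge (N1 + N2) (f * g).
Proof.
move=> f0 g0 m mN; rewrite fps_coefM big1 // => i _.
case: (ltnP i N1) => [/f0->|iN]; first by rewrite mul0r.
rewrite g0 ?mulr0 // ltn_subLR; last by rewrite -ltnS ltn_ord.
by rewrite (leq_trans mN) // leq_add2r.
Qed.

Lemma fps_ord_geMr N f g : fps_ord_ge N f -> fps_ord_ge N (f * g).
Proof. by move=> f0; rewrite -[N]addn0; apply: fps_ord_geM. Qed.

Lemma fps_ord_geW N1 N2 f :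
  (N1 <= N2)%N -> fps_ord_ge N2 f -> fps_ord_ge N1 f.
Proof. by move=> N12 f0 m mN; apply: f0; apply: leq_trans N12. Qed.

Lemma fps_ord_ge_exp f n : f``_0 = 0 -> fps_ord_ge n (f ^+ n).
Proof.
move=> f0; elim: n => [|n IHn]; first by move=> m.
by rewrite exprS -add1n; apply: fps_ord_geM => // -[].
Qed.

Lemma fps_ord_ge_cvg u :
    (forall n, fps_ord_ge n (u n.+1 - u n)) ->
  fps_cvg_to u (fps_lim u).
Proof.
move=> du; suff ul : fps_cvg_to u (FPS (fun m => (u m.+1)``_m)).
  by rewrite (fps_limE ul).
move=> m; exists m.+1; elim=> // n IHn; rewrite leq_eqVlt => /predU1P[<-//|mn].
by rewrite -[u n.+1](subrK (u n)) fps_coefD du ?add0r ?IHn.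
Qed.

Lemma qpoch_inf_cvg (a q : fps R) :
  q``_0 = 0 -> fps_cvg_to (qpoch a q) (qpoch_inf a q).
Proof.
move=> q0; apply: fps_ord_ge_cvg => n.
rewrite /qpoch big_ord_recr /= mulrBr mulr1 addrAC subrr add0r mulrA mulrC.
by rewrite -mulrN; apply/fps_ord_geMr/fps_ord_ge_exp.
Qed.

Lemma fps_series_cvg m u : (forall n, fps_ord_ge n (u n)) ->
  fps_cvg_to (fun N => \sum_(m <= n < N) u n) (fps_series m u).
Proof.
move=> u0; apply: fps_ord_ge_cvg => n; case: (leqP m n) => mn.
  by rewrite big_nat_recr //= addrAC subrr add0r.
by rewrite (big_geq mn) (big_geq (ltnW mn)) subrr.
Qed.

Lemma fps_series_expX_cvg m (e : nat -> nat) (c : nat -> fps R) :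
    (forall n, (n <= e n)%N) ->
  fps_cvg_to (fun N => \sum_(m <= n < N) fpsX R ^+ e n * c n)
             (fps_series m (fun n => fpsX R ^+ e n * c n)).
Proof.
move=> le_e; apply: fps_series_cvg => n; apply: fps_ord_geMr.
by apply: fps_ord_geW (le_e n) _; apply: fps_ord_ge_exp.
Qed.

Lemma fps_coef0M f g : (f * g)``_0 = f``_0 * g``_0.
Proof. by rewrite fps_coefM big_ord1. Qed.

Lemma fps_unit1 f : f``_0 = 1 -> f \is a GRing.unit.
Proof.
move=> f1; pose h := 1 - f; pose u n := \sum_(0 <= i < n) h ^+ i.
have h0 : h``_0 = 0 by rewrite /h fps_coefD /= f1 subrr.
have uV n : u n * f = 1 - h ^+ n.
  have fE : f = - (h - 1) by rewrite opprB /h subKr.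
  by rewrite {1}fE /u big_mkord mulrC mulNr -subrX1 opprB.
have ul := @fps_series_cvg 0 _ (fun n => @fps_ord_ge_exp h n h0).
suff lf : fps_series 0 (fun n => h ^+ n) * f = 1.
  by apply/asboolP; eexists; exact: lf.
apply/fpsP => m.
have [N uN] : exists N, forall n, (N <= n)%N -> forall i, (i <= m)%N ->
    (u n)``_i = (fps_series 0 (fun n => h ^+ n))``_i.
  elim: m => [|m [N IHm]].
    by have [N uN] := ul 0%N; exists N => n /uN ? i; rewrite leqn0 => /eqP->.
  have [N' uN'] := ul m.+1; exists (maxn N N') => n.
  rewrite geq_max => /andP[Nn N'n] i; rewrite leq_eqVlt => /predU1P[->|im].
    exact: uN'.
  exact: IHm.
pose M := maxn N m.+1.
have -> : (fps_series 0 (fun n => h ^+ n) * f)``_m = (u M * f)``_m.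
  rewrite !fps_coefM; apply: eq_bigr => i _; congr (_ * _).
  by apply/esym/uN; [exact: leq_maxl | rewrite -ltnS].
rewrite uV fps_coefD /= (fps_ord_ge_exp h0) ?oppr0 ?addr0 //.
exact: leq_maxr.
Qed.

Lemma qpoch_coef0 (a q : fps R) n : a``_0 = 0 -> (qpoch a q n)``_0 = 1.
Proof.
move=> a0; elim: n => [|n IHn]; first by rewrite /qpoch big_ord0.
rewrite /qpoch big_ord_recr fps_coef0M IHn mul1r fps_coefD fps_coefN.
by rewrite fps_coef0M a0 mul0r oppr0 addr0.
Qed.

Lemma qpoch_unit (a q : fps R) n : a``_0 = 0 -> qpoch a q n \is a GRing.unit.
Proof. by move=> a0; apply/fps_unit1/qpoch_coef0. Qed.

Lemma qpoch_inf_unit (a q : fps R) :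
  a``_0 = 0 -> q``_0 = 0 -> qpoch_inf a q \is a GRing.unit.
Proof.
move=> a0 q0; apply: fps_unit1; have [N uN] := qpoch_inf_cvg a q0 0%N.
by rewrite -(uN N) // qpoch_coef0.
Qed.

End WellDefined.

(* Main.v *)
(** Put [Q = q^2]. Euler's identity [(-q;q)_oo (q;q^2)_oo = 1] reduces the
    theorem to the Andrews-Merca truncated pentagonal number theorem
      [\sum_(n < 2k) (-1)^(T_n) Q^(G_n) = (Q;Q)_oo (1 + (-1)^(k-1) S_k)],
    where [S_k = \sum_(n >= 1) Q^('C(k,2) + (k+1) n) / (Q;Q)_n * [n-1, k-1]_Q].
    This follows by induction on [k]: in [S_k + S_(k+1)] the two [n]-th terms
    combine, with [n = k + m], into
      [Q^(G_(2k)) / (Q;Q)_k * Q^((k+1) m) (1 - Q^k + Q^(k+m)) / (Q;Q)_m],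
    and Euler's sum [\sum_m Q^((j+1) m) / (Q;Q)_m = (Q;Q)_j / (Q;Q)_oo] for
    [j = k] and [j = k+1] gives
      [(Q;Q)_oo (S_k + S_(k+1)) = Q^(G_(2k)) (1 - Q^(2k+1))
                                = Q^(G_(2k)) - Q^(G_(2k+1))]. *)
Require Import Defs.
From mathcomp Require Import all_boot all_order all_algebra.
From mathcomp Require Import boolp zify ring.

Set Implicit Arguments.
Unset Strict Implicit.
Unset Printing Implicit Defensive.

Import GRing.Theory.
Local Open Scope ring_scope.

(** * Algebra of coefficientwise limits *)

Section Convergence.
Variable R : comNzRingType.
Implicit Types (f l : fps R) (u v : nat -> fps R).

Lemma fps_cvg_cst f : fps_cvg_to (fun=> f) f.
Proof. by move=> m; exists 0%N. Qed.

Lemma fps_cvgD u v l1 l2 : fps_cvg_to u l1 -> fps_cvg_to v l2 ->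
  fps_cvg_to (fun n => u n + v n) (l1 + l2).
Proof.
move=> ul vl m; have [N1 uN] := ul m; have [N2 vN] := vl m.
exists (maxn N1 N2) => n; rewrite geq_max => /andP[n1 n2].
by rewrite !fps_coefD uN ?vN.
Qed.

(** Coefficient [m] of a product involves all lower coefficients of both factors, so [fps_cvgM]
    needs one rank serving every [i <= m]. *)
Lemma fps_cvg_bounded u l : fps_cvg_to u l ->
  forall m, exists N, forall n, (N <= n)%N ->
    forall i, (i <= m)%N -> (u n)``_i = l``_i.
Proof.
move=> ul; elim=> [|m [N IHm]].
  by have [N uN] := ul 0%N; exists N => n /uN ? i; rewrite leqn0 => /eqP->.
have [N' uN'] := ul m.+1; exists (maxn N N') => n.
rewrite geq_max => /andP[Nn N'n] i; rewrite leq_eqVlt => /predU1P[->|im].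
  exact: uN'.
exact: IHm.
Qed.

Lemma fps_cvgM u v l1 l2 : fps_cvg_to u l1 -> fps_cvg_to v l2 ->
  fps_cvg_to (fun n => u n * v n) (l1 * l2).
Proof.
move=> /fps_cvg_bounded ul /fps_cvg_bounded vl m.
have [N1 uN] := ul m; have [N2 vN] := vl m.
exists (maxn N1 N2) => n; rewrite geq_max => /andP[n1 n2].
rewrite !fps_coefM; apply: eq_bigr => i _.
by rewrite uN ?vN ?leq_subr // -ltnS.
Qed.

Lemma fps_cvgMl f u l : fps_cvg_to u l -> fps_cvg_to (fun n => f * u n) (f * l).
Proof. by apply: fps_cvgM; apply: fps_cvg_cst. Qed.

Lemma fps_cvg_sub u l (s : nat -> nat) : (forall n, (n <= s n)%N) ->
  fps_cvg_to u l -> fps_cvg_to (fun n => u (s n)) l.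
Proof.
move=> les ul m; have [N uN] := ul m.
by exists N => n Nn; apply: uN; apply: leq_trans (les n).
Qed.

Lemma fps_cvg_shift u l (N0 : nat) :
  fps_cvg_to (fun n => u (n + N0)%N) l -> fps_cvg_to u l.
Proof.
move=> ul m; have [N uN] := ul m; exists (N + N0)%N => n Nn.
have le0 : (N0 <= n)%N by apply: leq_trans Nn; apply: leq_addl.
by rewrite -(subnK le0); apply: uN; rewrite leq_subRL // addnC.
Qed.

Lemma eq_fps_cvg u v l : u =1 v -> fps_cvg_to v l -> fps_cvg_to u l.
Proof.
by move=> uv vl m; have [N vN] := vl m; exists N => n; rewrite uv; apply: vN.
Qed.

Lemma fps_ord_ge_expM (Q : fps R) (c e n : nat) f :
  Q``_0 = 0 -> (n <= e)%N -> fps_ord_ge n (Q ^+ (c + e) * f).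
Proof.
move=> Q0 ne; apply: fps_ord_geMr; apply: (@fps_ord_geW _ _ (c + e)).
  exact: leq_trans (leq_addl _ _).
exact: fps_ord_ge_exp.
Qed.

End Convergence.

(** * Euler's sum in base [Q] *)

Section QSeries.
Variables (R : comNzRingType) (Q : fps R).
Hypothesis Q0 : Q``_0 = 0.

Local Notation qfact := (qpoch Q Q).

Lemma qpoch0 (a q : fps R) : qpoch a q 0 = 1.
Proof. by rewrite /qpoch big_ord0. Qed.

Lemma qpochS (a q : fps R) n : qpoch a q n.+1 = qpoch a q n * (1 - a * q ^+ n).
Proof. by rewrite /qpoch big_ord_recr. Qed.

Lemma qpochQS n : qfact n.+1 = qfact n * (1 - Q ^+ n.+1).
Proof. by rewrite qpochS exprS. Qed.

Lemma qpochQV n : (qfact n)^-1 * qfact n = 1.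
Proof. by rewrite mulVr ?qpoch_unit. Qed.

Lemma qpochQVS n : (qfact n)^-1 = (1 - Q ^+ n.+1) * (qfact n.+1)^-1.
Proof.
apply: (mulIr (qpoch_unit Q n.+1 Q0)).
by rewrite -mulrA qpochQV qpochQS mulrA qpochQV mul1r mulr1.
Qed.

(** Euler's sum of [z^m / (Q;Q)_m] at [z = Q^(j+1)]; the shift by one makes it converge already for
    [j = 0]. *)
Definition euler_series (j : nat) : fps R :=
  fps_series 0 (fun m => Q ^+ (j.+1 * m) / qfact m).

Lemma euler_series_cvg j :
  fps_cvg_to (fun N => \sum_(0 <= m < N) Q ^+ (j.+1 * m) / qfact m)
             (euler_series j).
Proof.
apply: fps_series_cvg => n; rewrite -[(j.+1 * n)%N]add0n.
by apply: fps_ord_ge_expM => //; rewrite leq_pmull.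
Qed.

(** This is [F(zQ) = F(z) - z F(z)], from [(1 - Q^m) / (Q;Q)_m = 1 / (Q;Q)_(m-1)]. It is exact on
    partial sums once the one multiplied by [z] has one term fewer. *)
Lemma euler_seriesS j : euler_series j.+1 = (1 - Q ^+ j.+1) * euler_series j.
Proof.
apply: fps_cvg_unique (euler_series_cvg j.+1) _.
rewrite mulrBl mul1r -mulNr; apply: (fps_cvg_shift (N0 := 1)).
apply: eq_fps_cvg (fps_cvgD
  (fps_cvg_sub (fun n => leqnSn n) (euler_series_cvg j))
  (fps_cvgMl (- Q ^+ j.+1) (euler_series_cvg j))) => N.
rewrite addn1 !big_nat_recl //= !muln0 -addrA; congr (_ + _).
rewrite mulr_sumr -big_split /=; apply: eq_bigr => m _.
rewrite [(qfact m)^-1]qpochQVS.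
rewrite (_ : (j.+2 * m.+1 = m.+1 + (j.+1 + j.+1 * m))%N); last by lia.
by rewrite (_ : (j.+1 * m.+1 = j.+1 + j.+1 * m)%N) ?exprD; [ring | lia].
Qed.

(** At [z = Q] the partial sums telescope to [1 / (Q;Q)_N]. *)
Lemma euler_series0 : euler_series 0 * qpoch_inf Q Q = 1.
Proof.
have sumE N : \sum_(0 <= m < N.+1) Q ^+ (1 * m) / qfact m = (qfact N)^-1.
  elim: N => [|N IHN]; first by rewrite big_nat1 expr0 mul1r.
  by rewrite big_nat_recr //= IHN qpochQVS mul1n; ring.
apply: (fps_cvg_unique _ (fps_cvg_cst 1)).
apply: eq_fps_cvg (fps_cvgM
  (fps_cvg_sub (fun n => leqnSn n) (euler_series_cvg 0)) (qpoch_inf_cvg Q Q0)).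
by move=> n; rewrite sumE qpochQV.
Qed.

Lemma euler_seriesE j : euler_series j * qpoch_inf Q Q = qfact j.
Proof.
elim: j => [|j IHj]; first by rewrite qpoch0 euler_series0.
by rewrite euler_seriesS -mulrA IHj qpochQS mulrC.
Qed.

(** * The Andrews-Merca series and its two-term recurrence *)

Definition am_term (k n : nat) : fps R :=
  Q ^+ ('C(k.+1, 2) + k.+2 * n) / qfact n * qbinom Q (n - 1) k.

(* [am_series k] is [S_(k+1)] of the header. *)
Definition am_series (k : nat) : fps R := fps_series 1 (am_term k).

Lemma am_series_cvg k :
  fps_cvg_to (fun N => \sum_(1 <= n < N) am_term k n) (am_series k).
Proof.
apply: fps_series_cvg => n; rewrite /am_term -mulrA.
by apply: fps_ord_ge_expM => //; rewrite leq_pmull.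
Qed.

Lemma qbinom_addl k m :
  qbinom Q (k + m) k = (1 - Q ^+ k.+1) * qfact (k + m) / (qfact k.+1 * qfact m).
Proof.
rewrite /qbinom leq_addr addKn !invrM ?qpoch_unit // [(qfact k)^-1]qpochQVS.
by ring.
Qed.

Lemma qbinom_addS k m :
  qbinom Q (k + m) k.+1 = (1 - Q ^+ m) * qfact (k + m) / (qfact k.+1 * qfact m).
Proof.
rewrite /qbinom -addn1 leq_add2l subnDl addn1.
(* At [m = 0] the binomial is out of range, and the factor [1 - Q^0] vanishes as well. *)
case: m => [|m]; first by rewrite expr0 subrr !mul0r.
rewrite subn1 /= !invrM ?qpoch_unit // [(qfact m)^-1]qpochQVS.
by ring.
Qed.

Lemma am_termD k m :
  am_term k (k.+1 + m) + am_term k.+1 (k.+1 + m) =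
  Q ^+ ('C(k.+1, 2) + k.+2 * k.+1) / qfact k.+1 *
    ((1 - Q ^+ k.+1) * (Q ^+ (k.+2 * m) / qfact m)
     + Q ^+ k.+1 * (Q ^+ (k.+3 * m) / qfact m)).
Proof.
(* With [a = Q^(k+1)] and [b = Q^m], the numerators add up to [1 - a + a^2 b (1 - b) = (1 - a b) (1
   - a + a b)]; [canc] absorbs the factor [1 - a b]. *)
have canc : (qfact (k.+1 + m))^-1 * qfact (k + m) * (1 - Q ^+ (k.+1 + m)) = 1.
  by rewrite addSn -mulrA -qpochQS qpochQV.
rewrite /am_term (_ : (k.+1 + m - 1 = k + m)%N); last by lia.
rewrite qbinom_addl qbinom_addS !invrM ?qpoch_unit // (binS k.+1 1) bin1.
rewrite (_ : ('C(k.+1, 2) + k.+2 * (k.+1 + m)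
              = 'C(k.+1, 2) + k.+2 * k.+1 + k.+2 * m)%N); last by lia.
rewrite (_ : ('C(k.+1, 2) + k.+1 + k.+3 * (k.+1 + m)
              = 'C(k.+1, 2) + k.+2 * k.+1 + k.+2 * m
                + (k.+1 + (k.+1 + m)))%N); last by lia.
rewrite (_ : (k.+3 * m = k.+2 * m + m)%N); last by lia.
rewrite -[RHS]mul1r -[X in _ = X * _]canc.
move: ('C(k.+1, 2) + _)%N (k.+2 * m)%N => c e.
by rewrite !exprD; ring.
Qed.

Lemma am_seriesD k :
  am_series k + am_series k.+1 =
  Q ^+ ('C(k.+1, 2) + k.+2 * k.+1) / qfact k.+1 *
    ((1 - Q ^+ k.+1) * euler_series k.+1 + Q ^+ k.+1 * euler_series k.+2).
Proof.
(* Here [[n-1, i]_Q = 0], so both series may start at [n = k+1], which is [m = 0] in [am_termD]. *)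
have am_term0 i n : (0 < n <= i)%N -> am_term i n = 0.
  by move=> ni; rewrite /am_term /qbinom ifN ?mulr0 // -ltnNge; lia.
apply: fps_cvg_unique (fps_cvgD (am_series_cvg k) (am_series_cvg k.+1)) _.
apply: (fps_cvg_shift (N0 := k.+1)).
apply: eq_fps_cvg (fps_cvgMl _ (fps_cvgD (fps_cvgMl _ (euler_series_cvg k.+1))
  (fps_cvgMl _ (euler_series_cvg k.+2)))) => N.
rewrite -big_split (big_cat_nat _ (n := k.+1)) ?leq_addl //=.
rewrite big_nat big1 ?add0r => [|n /andP[n0 nk]]; last first.
  by rewrite !am_term0 ?addr0 ?n0 //= ltnW.
rewrite -{1}[k.+1]add0n big_addn addnK !mulr_sumr -big_split mulr_sumr /=.
by apply: eq_bigr => m _; rewrite addnC am_termD.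
Qed.

(** Euler's sum turns the bracket of [am_seriesD] into [(Q;Q)_(k+1)] times
    [1 - a + a (1 - Q^(k+2))], where [a = Q^(k+1)]. *)
Lemma am_seriesD_qpoch k :
  qpoch_inf Q Q * (am_series k + am_series k.+1) =
  Q ^+ ('C(k.+1, 2) + k.+2 * k.+1) * (1 - Q ^+ (2 * k.+1).+1).
Proof.
rewrite am_seriesD mulrC -[LHS]mulrA mulrDl -!(mulrA _ (euler_series _)).
rewrite !euler_seriesE [qfact k.+2]qpochQS.
have canc := qpochQV k.+1.
rewrite -[RHS]mul1r -[X in _ = X * _]canc.
rewrite (_ : ((2 * k.+1).+1 = k.+1 + k.+2)%N); last by lia.
by rewrite (exprD _ k.+1); ring.
Qed.

(** For [k = 0] every binomial is 1 and the exponent is [2n], so adding the missing term 1 gives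
    Euler's sum at [z = Q^2]. *)
Lemma am_series0 : qpoch_inf Q Q * (1 + am_series 0) = 1 - Q.
Proof.
suff -> : 1 + am_series 0 = euler_series 1.
  by rewrite mulrC euler_seriesE qpochQS qpoch0 mul1r expr1.
apply: fps_cvg_unique
  (fps_cvg_sub (fun n => leqnSn n)
    (fps_cvgD (fps_cvg_cst 1) (am_series_cvg 0))) _.
apply: eq_fps_cvg (fps_cvg_sub (fun n => leqnSn n) (euler_series_cvg 1)) => N /=.
rewrite [RHS]big_nat_recl // muln0 expr0 qpoch0 divr1 big_add1 /=; congr (_ + _).
apply: eq_bigr => n _; rewrite /am_term /qbinom bin_small // add0n leq0n.
by rewrite subn0 qpoch0 mul1r divrr ?qpoch_unit // mulr1.
Qed.

(** * The truncated pentagonal number theorem *)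

Lemma triangularE n : triangular n = 'C(n.+1, 2).
Proof. by rewrite /triangular bin2 /= addn1 mulnC divn2. Qed.

Lemma mul2_bin2 n : (2 * 'C(n.+1, 2) = n.+1 * n)%N.
Proof. by rewrite mul2n bin2 /= -[RHS]odd_double_half oddM /= andNb. Qed.

Theorem truncated_pentagonal k :
  \sum_(0 <= n < 2 * k.+1) (-1) ^+ triangular n * Q ^+ gen_pentagonal n =
  qpoch_inf Q Q * (1 + (-1) ^+ k * am_series k).
Proof.
elim: k => [|k IHk].
  rewrite expr0 mul1r am_series0 big_nat_recr // big_nat1 /=.
  by rewrite expr0 !expr1; ring.
rewrite (_ : (2 * k.+2 = (2 * k.+1).+2)%N); last by lia.
rewrite 2?big_nat_recr //= IHk.
have b1 := mul2_bin2 k; have b2 := mul2_bin2 k.+1.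
have b3 := mul2_bin2 (2 * k.+1); have b4 := mul2_bin2 (2 * k.+1).+1.
have pent0 : gen_pentagonal (2 * k.+1) = ('C(k.+1, 2) + k.+2 * k.+1)%N.
  by rewrite /gen_pentagonal mulKn // !triangularE; nia.
have pent1 : gen_pentagonal (2 * k.+1).+1
             = ('C(k.+1, 2) + k.+2 * k.+1 + (2 * k.+1).+1)%N.
  rewrite /gen_pentagonal (_ : ((2 * k.+1).+1 %/ 2 = k.+1)%N); last by lia.
  by rewrite !triangularE; nia.
rewrite pent0 pent1 !triangularE.
(* Only parity matters: [T_(2k+2) = (k+1)(2k+3)] and [T_(2k+3) = (k+2)(2k+3)], so the two new terms
   have opposite signs. *)
have sign0 : (-1) ^+ 'C((2 * k.+1).+1, 2) = (-1) ^+ k.+1 :> fps R.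
  rewrite (_ : 'C((2 * k.+1).+1, 2) = k.+1 + 2 * (k.+1 * k.+1))%N; last by nia.
  by rewrite exprD exprM sqrrN expr1n expr1n mulr1.
have sign1 : (-1) ^+ 'C((2 * k.+1).+2, 2) = - (-1) ^+ k.+1 :> fps R.
  rewrite (_ : 'C((2 * k.+1).+2, 2) = k.+2 + 2 * (k.+1 * k.+2))%N; last by nia.
  by rewrite exprD exprM sqrrN expr1n expr1n mulr1 exprS mulN1r.
rewrite sign0 sign1 (exprD _ _ (2 * k.+1).+1).
have := am_seriesD_qpoch k => step; apply/eqP; rewrite -subr_eq0; apply/eqP.
(* The difference of the two sides is, up to sign, the difference of the two sides of [step]. *)
transitivity ((-1) ^+ k.+1 * (Q ^+ ('C(k.+1, 2) + k.+2 * k.+1)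
  * (1 - Q ^+ (2 * k.+1).+1) - qpoch_inf Q Q * (am_series k + am_series k.+1))).
  by rewrite (exprS (-1) k); ring.
by rewrite step subrr mulr0.
Qed.

End QSeries.

(** * Euler's product identity and the final assembly *)

Lemma qpoch_odd_even (R : comNzRingType) (q : fps R) n :
  qpoch q (q ^+ 2) n * qpoch (q ^+ 2) (q ^+ 2) n = qpoch q q (2 * n).
Proof.
elim: n => [|n IHn]; first by rewrite !qpoch0 mulr1.
rewrite (_ : (2 * n.+1 = (2 * n).+2)%N); last by lia.
by rewrite !qpochS -IHn -!(exprM q 2) (exprS q (2 * n)); ring.
Qed.

Lemma qpoch_opp_mul (R : comNzRingType) (q : fps R) n :
  qpoch q q n * qpoch (- q) q n = qpoch (q ^+ 2) (q ^+ 2) n.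
Proof.
elim: n => [|n IHn]; first by rewrite !qpoch0 mulr1.
by rewrite !qpochS -IHn exprAC; ring.
Qed.

(** Multiplied by the unit [(q^2;q^2)_oo], the left side becomes [(-q;q)_oo (q;q)_oo] on splitting
    exponents by parity, and [(1 - q^i)(1 + q^i) = 1 - q^(2i)] gives back that unit. *)
Lemma qpoch_inf_opp (R : comNzRingType) (q : fps R) : q``_0 = 0 ->
  qpoch_inf (- q) q * qpoch_inf q (q ^+ 2) = 1.
Proof.
move=> q0; have q20 : (q ^+ 2)``_0 = 0 by rewrite fps_coef0M q0 mul0r.
have odd_even :
    qpoch_inf q (q ^+ 2) * qpoch_inf (q ^+ 2) (q ^+ 2) = qpoch_inf q q.
  apply: fps_cvg_unique
    (fps_cvgM (qpoch_inf_cvg q q20) (qpoch_inf_cvg (q ^+ 2) q20)) _.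
  apply: eq_fps_cvg (fps_cvg_sub (s := muln 2) _ (qpoch_inf_cvg q q0)) => n.
    exact: qpoch_odd_even.
  exact: leq_pmull.
have opp_mul : qpoch_inf q q * qpoch_inf (- q) q = qpoch_inf (q ^+ 2) (q ^+ 2).
  apply: fps_cvg_unique
    (fps_cvgM (qpoch_inf_cvg q q0) (qpoch_inf_cvg (- q) q0)) _.
  by apply: eq_fps_cvg (qpoch_inf_cvg (q ^+ 2) q20) => n; apply: qpoch_opp_mul.
apply: (mulIr (qpoch_inf_unit q20 q20)); rewrite mul1r -[RHS]opp_mul -odd_even.
by ring.
Qed.

Unset Implicit Arguments.

Theorem theorem1p1 (R : comNzRingType) (k : nat) (hk : (0 < k)%N) :
  let q : fps R := fpsX R in
  qpoch_inf (- q) q *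
    \sum_(0 <= n < 2 * k) (-1) ^+ triangular n * q ^+ (2 * gen_pentagonal n)
  = qpoch_inf (q ^+ 2) (q ^+ 2) / qpoch_inf q (q ^+ 2)
    + (-1) ^+ (k - 1)
      * (qpoch_inf (q ^+ 2) (q ^+ 2) / qpoch_inf q (q ^+ 2))
      * fps_series 1 (fun n =>
          q ^+ (k * (k - 1) + 2 * (k + 1) * n) / qpoch (q ^+ 2) (q ^+ 2) n
          * qbinom (q ^+ 2) (n - 1) (k - 1)).
Proof.
case: k hk => // k _ q; rewrite subn1 [k.+1.-1]/=.
have q0 : q``_0 = 0 by [].
have q20 : (q ^+ 2)``_0 = 0 by rewrite fps_coef0M q0 mul0r.
(* Both sides now carry the factor [(-q;q)_oo]; what remains is the truncated theorem at
   [Q = q^2]. *)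
have -> : (qpoch_inf q (q ^+ 2))^-1 = qpoch_inf (- q) q.
  apply: (mulIr (qpoch_inf_unit q0 q20)).
  by rewrite mulVr ?qpoch_inf_opp ?qpoch_inf_unit.
under eq_bigr => n _ do rewrite exprM.
rewrite (truncated_pentagonal q20) /am_series.
have -> : am_term (q ^+ 2) k = fun n =>
    q ^+ (k.+1 * k + 2 * (k.+1 + 1) * n) / qpoch (q ^+ 2) (q ^+ 2) n
    * qbinom (q ^+ 2) (n - 1) k.
  by apply/funext => n; rewrite /am_term -exprM mulnDr mul2_bin2 addn1 mulnA.
by ring.
Qed.
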